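(* Suppose that $\{\Theta_\omega\}_{\omega\in\Omega}$ is a $cg$-orthonormal basis for $H$ with respect to $\{H_\omega\}_{\omega\in\Omega}$. Then every $cg$-frame for $H$ with respect to $\{H_\omega\}_{\omega\in\Omega}$ can be written as a linear combination of two Parseval $cg$-frames; that is, for every $cg$-frame $\{\Lambda_\omega\}_{\omega\in\Omega}$ there exist Parseval $cg$-frames $\{\Gamma_\omega\}_{\omega\in\Omega}$ and $\{\Psi_\omega\}_{\omega\in\Omega}$ for $H$ with respect to $\{H_\omega\}_{\omega\in\Omega}$ and scalars $a,b$ such that $\Lambda_\omega=a\Gamma_\omega+b\Psi_\omega$ for $\mu$-almost every $\omega\in\Omega$.
   Context: $H$ is a separable Hilbert space, $(\Omega,\mu)$ is a measure space with positive measure $\mu$, and $\{H_\omega\}_{\omega\in\Omega}$ is a family of separable Hilbert spaces. $B(H,H_\omega)$ is the space of bounded linear operators from $H$ to $H_\omega$. A $\varphi\in\prod_{\omega\in\Omega}H_\omega$ is strongly measurable if it is measurable as a mapping from $\Omega$ to the direct sum $\oplus_{\omega\in\Omega}H_\omega$. $(\oplus_{\omega\in\Omega}H_\omega,\mu)_{L^2}$ is the Hilbert space of strongly measurable $\varphi$ with $\int_\Omega\|\varphi(\omega)\|^2d\mu(\omega)<\infty$, with inner product $\langle\varphi,\psi\rangle=\int_\Omega\langle\varphi(\omega),\psi(\omega)\rangle d\mu(\omega)$. A family $\{\Lambda_\omega\in B(H,H_\omega)\}_{\omega\in\Omega}$ is a $cg$-frame for $H$ with respect to $\{H_\omega\}_{\omega\in\Omega}$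 if (i) $\{\Lambda_\omega f\}_{\omega\in\Omega}$ is strongly measurable for each $f\in H$, and (ii) there are constants $A,B>0$ with $A\|f\|^2\le\int_\Omega\|\Lambda_\omega f\|^2d\mu(\omega)\le B\|f\|^2$ for all $f\in H$. It is a Parseval $cg$-frame if one can take $A=B=1$. A family $\{\Lambda_\omega\in B(H,H_\omega)\}_{\omega\in\Omega}$ is a $cg$-orthonormal basis for $H$ with respect to $\{H_\omega\}_{\omega\in\Omega}$ if (i) for each $h\in H$, $\{\Lambda_\omega h\}_{\omega\in\Omega}$ is strongly measurable; (ii) for almost all $\nu\in\Omega$, $\int_\Omega\langle\Lambda_\omega^*f_\omega,\Lambda_\nu^*g_\nu\rangle d\mu(\omega)=\langle f_\nu,g_\nu\rangle$ for all $\{f_\omega\}_{\omega\in\Omega}\in(\oplus_{\omega\in\Omega}H_\omega,\mu)_{L^2}$ and $g_\nu\in H_\nu$; (iii) for each $h\in H$, $\int_\Omega\|\Lambda_\omega h\|^2d\mu(\omega)=\|h\|^2$. *)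

(* Defs.v *)
From HB Require Import structures.
From mathcomp Require Import all_boot all_order all_algebra.
From mathcomp Require Import all_classical all_reals all_analysis.
From mathcomp Require Export complex.

Set Implicit Arguments.
Unset Strict Implicit.
Unset Printing Implicit Defensive.

Import Order.TTheory GRing.Theory Num.Theory.
Import numFieldNormedType.Exports.

Local Open Scope classical_set_scope.
Local Open Scope ring_scope.

(* Complex Hilbert spaces: Banach spaces over R[i] whose norm comes from an
   inner product, linear in the first and antilinear in the second argument. *)
HB.mixin Record CompleteNormedModule_isHilbert (R : realType) H
    of CompleteNormedModule R[i] H := {
  inner : {dot H for (@Num.conj R[i])} ;
  inner_normE : forall x : H, inner x x = `|x| ^+ 2
}.

#[short(type="hilbertType")]
HB.structure Definition Hilbert (R : realType) :=
  {H of CompleteNormedModule R[i] H & CompleteNormedModule_isHilbert R H}.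

(* The library norm of a normed module over R[i] takes its values in R[i];
   [rnorm] is the same norm, read as a real number. *)
Definition rnorm (R : realType) (H : hilbertType R) (x : H) : R :=
  complex.Re `|x|.

Definition separable (T : topologicalType) : Prop :=
  exists D : set T, countable D /\ dense D.

Record bounded_operator (R : realType) (H K : hilbertType R) := BoundedOperator {
  bop_fun :> {linear H -> K} ;
  bop_bounded : exists M : R, forall x : H, rnorm (bop_fun x) <= M * rnorm x
}.

Notation "''B' ( H , K )" := (bounded_operator H K)
  (at level 8, format "''B' ( H ,  K )") : type_scope.

(* [adjoint T y] is the x with <h, x> = <T h, y> for all h.  By the Riesz
   representation theorem there is exactly one such x, so that the default
   value of [xget] is never used. *)
Definition adjoint (R : realType) (H K : hilbertType R) (T : 'B(H, K)) (y : K) : H :=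
  xget 0 [set x | forall h : H, inner h x = inner (T h) y].

Section direct_sum.
Context (R : realType) (I : choiceType) (H : I -> hilbertType R).
Implicit Types (x y : forall i, H i).

Definition sqnorm_sum x : \bar R := \esum_(i in [set: I]) (rnorm (x i) ^+ 2)%:E.

Definition direct_sum : set (forall i, H i) := [set x | (sqnorm_sum x < +oo)%E].

Definition open_direct_sum : set (set (forall i, H i)) :=
  [set U | U `<=` direct_sum /\
    forall x, U x -> exists e : R, 0 < e /\
      forall y, direct_sum y ->
        (sqnorm_sum (fun i => y i - x i)%R < (e ^+ 2)%:E)%E -> U y].

Definition borel_direct_sum : set (set (forall i, H i)) :=
  <<s direct_sum, open_direct_sum >>.

Definition direct_sum_inj (i : I) (v : H i) : forall j, H j :=
  dfwith (fun j => 0 : H j) i v.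

End direct_sum.

Section cg_frames.
Context (d : measure_display) (Omega : measurableType d) (R : realType).
Context (mu : {measure set Omega -> \bar R}).
Context (H : hilbertType R) (Hs : Omega -> hilbertType R).
Implicit Types (phi : forall w, Hs w) (L : forall w, 'B(H, Hs w)).

(* phi is seen as a map into the direct sum by identifying each H_w with its
   copy there; measurability is with respect to the Borel sets of the norm
   topology of the direct sum. *)
Definition strongly_measurable phi : Prop :=
  forall B, borel_direct_sum B ->
    measurable [set w | B (direct_sum_inj (phi w))].

Definition sqnorm_integral phi : \bar R :=
  (\int[mu]_w (rnorm (phi w) ^+ 2)%:E)%E.

Definition L2_direct_sum : set (forall w, Hs w) :=
  [set phi | strongly_measurable phi /\ (sqnorm_integral phi < +oo)%E].

Definition complex_integral (f : Omega -> R[i]) : R[i] :=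
  Complex (Rintegral mu setT (fun w => complex.Re (f w)))
          (Rintegral mu setT (fun w => complex.Im (f w))).

Definition cg_frame_with (A B : R) L : Prop :=
  (forall f : H, strongly_measurable (fun w => L w f)) /\
  (forall f : H,
     ((A * rnorm f ^+ 2)%:E <= sqnorm_integral (fun w => L w f) /\
      sqnorm_integral (fun w => L w f) <= (B * rnorm f ^+ 2)%:E)%E).

Definition cg_frame L : Prop :=
  exists A B : R, [/\ 0 < A, 0 < B & cg_frame_with A B L].

Definition parseval_cg_frame L : Prop := cg_frame_with 1 1 L.

Definition cg_orthonormal_basis L : Prop :=
  [/\ forall h : H, strongly_measurable (fun w => L w h),
      {ae mu, forall v : Omega,
         forall f : forall w, Hs w, L2_direct_sum f -> forall g : Hs v,
           complex_integral
             (fun w => inner (adjoint (L w) (f w)) (adjoint (L v) g)) =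
           inner (f v) g} &
      forall h : H, sqnorm_integral (fun w => L w h) = (rnorm h ^+ 2)%:E].

End cg_frames.

(* Main.v *)
From HB Require Import structures.
Require Import Defs.
From mathcomp Require Import all_boot all_order all_algebra.
From mathcomp Require Import all_classical all_reals all_analysis.
From mathcomp Require Import measurable_realfun ring lra.

Import Order.TTheory GRing.Theory Num.Theory.
Import numFieldNormedType.Exports.

Local Open Scope classical_set_scope.
Local Open Scope ring_scope.

(* Let S be the frame operator of Lambda,
   <S f, f> = \int |Lambda_w f|^2, and let c^2 > ||S||.  Then
   X = (1 + i Q) / c and Y = (1 - i Q) / c with Q = sqrt (c^2 S^-1 - 1) satisfy
   X^* S X = Y^* S Y = 1, so Lambda X and Lambda Y are Parseval frames, and
   Lambda = (c/2) Lambda X + (c/2) Lambda Y everywhere.  Instead of S, the proof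
   works with the form b(f, g) = \int Re <Lambda_w f, Lambda_w g>, which is
   equivalent to the inner product: Q is the square root, with respect to b, of
   the form c^2 Re <f, g> - b(f, g). *)

Local Notation "t %:C" := (real_complex _ t).

(** * Real part of the inner product *)

Section real_part.
Context {R : realType} {H : hilbertType R}.
Implicit Types (x y z : H) (t : R) (a : R[i]).

Definition rdot x y : R := complex.Re (inner x y).

Lemma rnormE x : `|x| = (rnorm x)%:C.
Proof. by rewrite /rnorm RRe_real// ger0_real. Qed.

Lemma rnorm_ge0 x : 0 <= rnorm x.
Proof. by rewrite -ler0c -rnormE. Qed.

Lemma rdotxx x : rdot x x = rnorm x ^+ 2.
Proof. by rewrite /rdot inner_normE rnormE -rmorphXn. Qed.

Lemma rdotC x y : rdot x y = rdot y x.
Proof.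
have Re_conj (z : R[i]) : complex.Re z^* = complex.Re z by case: z.
by rewrite /rdot hermC expr0 mul1r Re_conj.
Qed.

Lemma rdotDl x y z : rdot (x + y) z = rdot x z + rdot y z.
Proof.
have ReD (u v : R[i]) : complex.Re (u + v) = complex.Re u + complex.Re v.
  by case: u; case: v.
by rewrite /rdot linearDl ReD.
Qed.

Lemma rdotZl t x y : rdot (t%:C *: x) y = t * rdot x y.
Proof.
have ReM (u : R[i]) : complex.Re (t%:C * u) = t * complex.Re u.
  by case: u => u v /=; rewrite mul0r subr0.
by rewrite /rdot linearZl_LR ReM.
Qed.

Lemma rdot_adj a x y : rdot (a *: x) y = rdot x (a^* *: y).
Proof. by rewrite /rdot linearZl_LR linearZr_LR /= conjCK. Qed.

End real_part.

(* The conditions saying that [b] is the real part of a Hermitian form. *)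
Record hermitian_re {R : realType} {H : hilbertType R} (b : H -> H -> R) : Prop :=
  HermitianRe {
    hreC : forall x y, b x y = b y x;
    hreDl : forall x y z, b (x + y) z = b x z + b y z;
    hreZl : forall (t : R) x y, b (t%:C *: x) y = t * b x y;
    hre_adj : forall (a : R[i]) x y, b (a *: x) y = b x (a^* *: y) }.

Arguments hreC {R H b}.
Arguments hreDl {R H b}.
Arguments hreZl {R H b}.
Arguments hre_adj {R H b}.

Lemma hermitian_re_rdot {R : realType} {H : hilbertType R} :
  hermitian_re (@rdot R H).
Proof.
by split; [exact: rdotC|exact: rdotDl|exact: rdotZl|exact: rdot_adj].
Qed.

(** * Scalar estimates and completeness *)

Lemma discriminant_le (R : realFieldType) (p q s : R) : 0 <= s ->
  (forall t, 0 <= p + 2 * t * q + t ^+ 2 * s) -> q ^+ 2 <= p * s.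
Proof.
rewrite le_eqVlt => /predU1P[<-|s0] h.
  have [->|q0] := eqVneq q 0; first by rewrite mulr0 expr0n.
  (* For [s = 0] the condition is affine in [t]; if [q] is nonzero it takes the value -1 here. *)
  have := h (- (p + 1) / (2 * q)).
  rewrite mulr0 addr0.
  have -> : p + 2 * (- (p + 1) / (2 * q)) * q = -1 by field.
  by rewrite lerNr oppr0 ler10.
(* The minimiser of the quadratic in [t]. *)
have := h (- q / s).
have -> : p + 2 * (- q / s) * q + (- q / s) ^+ 2 * s = (p * s - q ^+ 2) / s.
  by field; rewrite gt_eqF.
by rewrite pmulr_lge0 ?invr_gt0// subr_ge0.
Qed.

(** Serves to turn Cauchy-Schwarz bounds into convergence. *)
Lemma sqr_cvg (R : realType) (f g : R^nat) (l M : R) :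
  (forall n, (f n - l) ^+ 2 <= M * g n) -> g n @[n --> \oo] --> (0 : R) ->
  f n @[n --> \oo] --> l.
Proof.
move=> h g0; apply/cvgrPdist_lt => e e0.
have /cvgrPdist_lt/(_ (e ^+ 2) (exprn_gt0 _ e0)) : M * g n @[n --> \oo] --> (0 : R).
  by rewrite -[X in _ --> X](mulr0 M); exact: cvgMr.
apply: filterS => n; rewrite sub0r normrN => /(le_lt_trans (ler_norm _)) hn.
rewrite -(@ltr_pXn2r _ 2) ?nnegrE ?normr_ge0// ?(ltW e0)//.
by rewrite real_normK ?num_real// -opprB sqrrN; exact: le_lt_trans hn.
Qed.

Lemma rnorm_complete {R : realType} {H : hilbertType R} (u : nat -> H) :
  (forall e : R, 0 < e -> exists N, forall m n, (N <= m)%N -> (N <= n)%N ->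
     rnorm (u m - u n) < e) ->
  exists z, rnorm (u n - z) @[n --> \oo] --> (0 : R).
Proof.
move=> hu.
have : cvg (u n @[n --> \oo]).
  apply/cauchy_cvgP/cauchy_exP => e e0.
  (* A positive element of [R[i]] is real, so its real part can serve as radius. *)
  have [Ie Re] : complex.Im e = 0 /\ 0 < complex.Re e.
    by move: e0; rewrite ltcE => /andP[/eqP].
  have [N hN] := hu _ Re.
  exists (u N); exists N => // n /= Nn.
  rewrite -ball_normE /ball_ /=.
  by rewrite rnormE ltcE /= Ie eqxx hN.
move=> /cvg_ex[/= z uz]; exists z.
apply/cvgrPdist_lt => e e0.
move/cvgrPdist_lt : uz => /(_ e%:C); rewrite ltcR => /(_ e0).
apply: filterS => n; rewrite rnormE ltcR sub0r normrN ger0_norm ?rnorm_ge0//.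
by rewrite -opprB /rnorm normrN.
Qed.

(** * Algebra of Hermitian forms *)

Section hermitian_re_theory.
Context {R : realType} {H : hilbertType R} {b : H -> H -> R}.
Hypothesis hb : hermitian_re b.
Implicit Types (x y z : H) (t : R) (a : R[i]).

Lemma hre0l x : b 0 x = 0.
Proof. by have := hreZl hb 0 0 x; rewrite scaler0 mul0r. Qed.

Lemma hreNl x y : b (- x) y = - b x y.
Proof. by apply/eqP; rewrite -addr_eq0 -(hreDl hb) addNr hre0l. Qed.

Lemma hreBl x y z : b (x - y) z = b x z - b y z.
Proof. by rewrite (hreDl hb) hreNl. Qed.

Lemma hreDr x y z : b z (x + y) = b z x + b z y.
Proof. by rewrite !(hreC hb z) (hreDl hb). Qed.

Lemma hreNr x y : b y (- x) = - b y x.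
Proof. by rewrite !(hreC hb y) hreNl. Qed.

Lemma hreBr x y z : b z (x - y) = b z x - b z y.
Proof. by rewrite hreDr hreNr. Qed.

Lemma hreZr t x y : b y (t%:C *: x) = t * b y x.
Proof. by rewrite !(hreC hb y) (hreZl hb). Qed.

(** The quadratic [b (x + t y) (x + t y)] in [t] is nonnegative. Semidefinite forms are covered
    because [form_operator] applies this to a form that may degenerate. *)
Lemma hre_CauchySchwarz x y : (forall z, 0 <= b z z) ->
  b x y ^+ 2 <= b x x * b y y.
Proof.
move=> b0; apply: discriminant_le => // t.
have := b0 (x + t%:C *: y).
rewrite (hreDl hb) !hreDr !(hreZl hb) !hreZr (hreC hb y x).
by set p := b x x; set q := b x y; set s := b y y; congr (0 <= _); ring.
Qed.

End hermitian_re_theory.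

(** * Forms equivalent to the inner product *)

Section equivalent_form.
Context {R : realType} {H : hilbertType R} {b : H -> H -> R} {A B : R}.
Hypotheses (hb : hermitian_re b) (A0 : 0 < A).
Hypotheses (Ab : forall x, A * rnorm x ^+ 2 <= b x x)
  (bB : forall x, b x x <= B * rnorm x ^+ 2).
Implicit Types (x y z : H) (t : R) (a : R[i]).

Lemma eqf_ge0 x : 0 <= b x x.
Proof. by apply: le_trans (Ab x); rewrite mulr_ge0 ?(ltW A0)// sqr_ge0. Qed.

(** The lower bound makes [b] definite, so vectors can be identified by testing against [b]. *)
Lemma eqf_inj x y : (forall z, b z x = b z y) -> x = y.
Proof.
move=> h; apply/subr0_eq; set d := x - y.
have : b d d = 0 by rewrite {2}/d (hreBr hb) h subrr.
have := Ab d; move=> + d0; rewrite d0 pmulr_rle0// => n0.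
apply/eqP; rewrite -normr_eq0 rnormE.
have : rnorm d ^+ 2 == 0 by rewrite eq_le n0 sqr_ge0.
by rewrite sqrf_eq0 => /eqP ->.
Qed.

(** The lower bound turns [b]-Cauchy into norm-Cauchy; the upper bound carries the norm limit back
    to [b]. *)
Lemma eqf_complete (u : nat -> H) :
  (forall e : R, 0 < e -> exists N, forall m n, (N <= m)%N -> (N <= n)%N ->
     b (u m - u n) (u m - u n) < e) ->
  exists z, b (u n - z) (u n - z) @[n --> \oo] --> (0 : R).
Proof.
move=> hu.
have [e e0|z uz] := @rnorm_complete R H u.
  have [|N hN] := hu (A * e ^+ 2); first by rewrite mulr_gt0// exprn_gt0.
  exists N => m n /hN/[apply] /(le_lt_trans (Ab _)).
  by rewrite ltr_pM2l// ltr_pXn2r// nnegrE ?rnorm_ge0// ltW.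
exists z.
have uz2 : B * rnorm (u n - z) ^+ 2 @[n --> \oo] --> (0 : R).
  have -> : (0 : R) = B * (0 * 0) by rewrite !mulr0.
  exact: cvgMr (cvgM uz uz).
apply: (squeeze_cvgr _ (@cvg_cst _ _ _ _ _) uz2).
by apply: nearW => n; rewrite eqf_ge0 bB.
Qed.

Lemma eqf_cvgl (u : nat -> H) z y :
  b (u n - z) (u n - z) @[n --> \oo] --> (0 : R) ->
  b (u n) y @[n --> \oo] --> b z y.
Proof.
move=> uz; apply: (@sqr_cvg R _ _ _ (b y y) _ uz) => n.
by rewrite -(hreBl hb) [leRHS]mulrC (hre_CauchySchwarz hb _ _ eqf_ge0).
Qed.

Lemma eqf_cvg2 (u : nat -> H) z :
  b (u n - z) (u n - z) @[n --> \oo] --> (0 : R) ->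
  b (u n) (u n) @[n --> \oo] --> b z z.
Proof.
move=> uz.
have -> : (fun n => b (u n) (u n)) =
    (fun n => b (u n - z) (u n - z) + (b (u n) z + b (u n) z - b z z)).
  apply/funext => n; rewrite (hreBl hb) !(hreBr hb) (hreC hb z (u n)).
  by set p := b (u n) (u n); set q := b _ z; set s := b z z; ring.
have uz' := eqf_cvgl u z z uz.
have := cvgD uz (cvgB (cvgD uz' uz') (cvg_cst (b z z))).
by rewrite add0r addrK; exact.
Qed.

(* Riesz representation: the representing vector minimises
   [b x x - 2 * phi x], and minimising sequences are Cauchy by the
   parallelogram law. *)
Lemma eqf_Riesz (phi : H -> R) (M : R) :
  (forall x y, phi (x + y) = phi x + phi y) ->
  (forall t x, phi (t%:C *: x) = t * phi x) ->
  0 <= M -> (forall x, phi x ^+ 2 <= M * b x x) ->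
  exists z, forall x, b x z = phi x.
Proof.
move=> phiD phiZ M0 phiM.
pose J x := b x x - 2 * phi x.
have Jge x : - M <= J x.
  have := phiM x; have := eqf_ge0 x; rewrite /J.
  set p := b x x; set q := phi x => p0 qp.
  (* After squaring: [4 q^2 <= 4 M p <= (p + M)^2]. *)
  have : 2 * q <= p + M.
    rewrite -[p + M]ger0_norm ?addr_ge0//; apply: le_trans (ler_norm _) _.
    rewrite -ler_sqr ?nnegrE ?normr_ge0// !real_normK ?num_real//.
    have := sqr_ge0 (p - M); lra.
  lra.
have infJ : has_inf (range J).
  by split; [exists (J 0); exists 0|exists (- M) => _ [x _ <-]].
pose m := inf (range J).
have mJ x : m <= J x by apply: ge_inf; [case: infJ|exists x].
have /choice[u uJ] (n : nat) : exists x, J x < m + n.+1%:R^-1.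
  have [|_ [x _ <-] hx] := @inf_adherent _ _ n.+1%:R^-1 _ infJ; last by exists x.
  by rewrite invr_gt0.
(* [m] bounds [J] from below at the midpoint of [x] and [y]. *)
have half x y : b (x - y) (x - y) <= 2 * J x + 2 * J y - 4 * m.
  have := mJ ((2^-1 : R)%:C *: (x + y)); rewrite /J.
  rewrite phiZ phiD (hreZl hb) (hreZr hb) !(hreDl hb) !(hreDr hb).
  rewrite !(hreNl hb) !(hreNr hb).
  rewrite (hreC hb y x); lra.
have [e e0|z uz] := @eqf_complete u.
  (* Two excesses over [m] below [e / 4], each doubled in [half], add up to less than [e]. *)
  have [N _ hN] : \forall n \near \oo, (n.+1%:R^-1 : R) < e / 4.
    by apply: near_infty_natSinv_lt (PosNum (divr_gt0 e0 _)).
  exists N => p q /hN/= hp /hN/= hq.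
  move: (half (u p) (u q)) (uJ p) (uJ q) hp hq.
  set p' := p.+1%:R^-1; set q' := q.+1%:R^-1.
  lra.
have phicvg : phi (u n) @[n --> \oo] --> phi z.
  apply: (@sqr_cvg R _ _ _ M _ uz) => n.
  have -> : phi (u n) - phi z = phi (u n - z).
    have <- : (-1 : R)%:C *: z = - z by rewrite rmorphN1 scaleN1r.
    by rewrite phiD phiZ mulN1r.
  exact: phiM.
have Jz : J z <= m.
  have Jcvg : J (u n) @[n --> \oo] --> J z.
    by apply: cvgB; [exact: eqf_cvg2|exact: cvgMr].
  have mcvg : m + n.+1%:R^-1 @[n --> \oo] --> m + (0 : R).
    by apply: cvgD; [exact: cvg_cst|exact: cvg_harmonic].
  rewrite -[m]addr0; apply: ler_cvg_to Jcvg mcvg _.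
  by apply: nearW => n; exact/ltW/uJ.
exists z => x; apply/eqP; rewrite -subr_eq0 -sqrf_eq0 eq_le sqr_ge0 andbT.
(* [J (z + t x) - J z] is a nonnegative quadratic in [t] without constant term, so its linear
   coefficient [2 (b x z - phi x)] vanishes. *)
rewrite -(mul0r (b x x)); apply: discriminant_le; first exact: eqf_ge0.
move=> t.
have := mJ (z + t%:C *: x); move: Jz; rewrite /J.
rewrite phiD phiZ (hreDl hb) !(hreDr hb) !(hreZl hb) !(hreZr hb) (hreC hb z x).
lra.
Qed.

End equivalent_form.

Lemma linear_exists {K : pzRingType} {U V : lmodType K} (f : U -> V) :
  (forall a x y, f (a *: x + y) = a *: f x + f y) ->
  exists F : {linear U -> V}, forall x, F x = f x.
Proof.
move=> lf; pose m := GRing.isLinear.Build _ _ _ _ f lf.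
by exists (HB.pack_for {linear U -> V} f m).
Qed.

(** * The seminorm of a positive form *)

Definition form_norm {R : realType} {H : hilbertType R} (b : H -> H -> R)
  (x : H) : R := Num.sqrt (b x x).

Section form_norm.
Context {R : realType} {H : hilbertType R} {b : H -> H -> R}.
Hypotheses (hb : hermitian_re b) (b0 : forall x, 0 <= b x x).
Implicit Types (x y z : H) (t : R).

Local Notation N := (form_norm b).

Lemma form_norm_ge0 x : 0 <= N x.
Proof. exact: sqrtr_ge0. Qed.

Lemma form_norm_sqr x : N x ^+ 2 = b x x.
Proof. by rewrite sqr_sqrtr. Qed.

Lemma form_normD x y : N (x + y) <= N x + N y.
Proof.
rewrite -ler_sqr ?nnegrE ?addr_ge0 ?form_norm_ge0// sqrrD !form_norm_sqr.
rewrite (hreDl hb) !(hreDr hb) (hreC hb y x).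
suff : b x y <= N x * N y by lra.
apply: le_trans (ler_norm _) _.
rewrite -ler_sqr ?nnegrE ?normr_ge0 ?mulr_ge0 ?form_norm_ge0//.
by rewrite real_normK ?num_real// exprMn !form_norm_sqr hre_CauchySchwarz.
Qed.

Lemma form_normZ t x : 0 <= t -> N (t%:C *: x) = t * N x.
Proof.
move=> t0; rewrite /form_norm (hreZl hb) (hreZr hb) mulrA -expr2.
by rewrite sqrtrM ?sqr_ge0// sqrtr_sqr ger0_norm.
Qed.

End form_norm.

(** * Square roots by iteration *)

Section sqrt_iteration.
Context {R : realType} {H : hilbertType R}.
Context (E : {linear H -> H}).
Implicit Types (x y z : H) (n : nat).

(* The iterates converge to the solution [Z = 1 - sqrt (1 - E)] of
   [Z = (E + Z ^ 2) / 2]. *)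
Fixpoint sqrt_iter n : H -> H :=
  if n is m.+1 then
    fun x => (2^-1 : R)%:C *: (E x + sqrt_iter m (sqrt_iter m x))
  else fun=> 0.
Local Notation Z := sqrt_iter.

Lemma sqrt_iterP n (a : R[i]) x y : Z n (a *: x + y) = a *: Z n x + Z n y.
Proof.
elim: n a x y => [|n IH] a x y /=; first by rewrite scaler0 addr0.
rewrite !IH linearP scalerA [a * _]mulrC -scalerA.
by rewrite -scalerDr [a *: (_ + _)]scalerDr addrACA.
Qed.

Lemma sqrt_iterB n x y : Z n (x - y) = Z n x - Z n y.
Proof. by rewrite addrC -scaleN1r sqrt_iterP scaleN1r addrC. Qed.

(** Each iterate is a polynomial in [E]. *)
Lemma sqrt_iter_comm (F : H -> H) :
  (forall (a : R[i]) x y, F (a *: x + y) = a *: F x + F y) ->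
  (forall x, E (F x) = F (E x)) -> forall n x, Z n (F x) = F (Z n x).
Proof.
move=> lF EF; have F0 : F 0 = 0.
  by have := lF (-1) 0 0; rewrite scaleN1r oppr0 addr0 scaleN1r addNr.
have FZ a x : F (a *: x) = a *: F x by rewrite -[a *: x]addr0 lF F0 addr0.
have FD x y : F (x + y) = F x + F y.
  by rewrite -[x in LHS]scale1r lF scale1r.
by elim=> [|n IH] x /=; rewrite ?F0// EF !IH FZ FD.
Qed.

Lemma sqrt_iter_commZ m n x : Z m (Z n x) = Z n (Z m x).
Proof.
apply: sqrt_iter_comm => [|{}x]; first exact: sqrt_iterP.
by apply/esym/sqrt_iter_comm => //; exact: linearP.
Qed.

(** As the iterates commute, the difference of the squares of [Z n.+1] and [Z n] factors into sum
    times difference. *)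
Lemma sqrt_iter_step n x :
  Z n.+2 x - Z n.+1 x =
  (2^-1 : R)%:C *: (Z n.+1 (Z n.+1 x - Z n x) + Z n (Z n.+1 x - Z n x)).
Proof.
have ZS m y : Z m.+1 y = (2^-1 : R)%:C *: (E y + Z m (Z m y)) by [].
rewrite !sqrt_iterB (sqrt_iter_commZ n n.+1) addrA subrK.
rewrite [Z n.+2 x]ZS [X in _ - X = _]ZS -scalerBr opprD addrACA subrr add0r.
by [].
Qed.

Context {b : H -> H -> R}.
Hypotheses (hb : hermitian_re b) (b0 : forall x, 0 <= b x x).
Local Notation N := (form_norm b).

Lemma sqrt_iter_sym : (forall x y, b (E x) y = b x (E y)) ->
  forall n x y, b (Z n x) y = b x (Z n y).
Proof.
move=> symE; elim=> [|n IH] x y /=; first by rewrite (hre0l hb) (hreC hb) (hre0l hb).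
by rewrite (hreZl hb) (hreZr hb) (hreDl hb) (hreDr hb) symE !IH.
Qed.

Context {rho : R}.
Hypotheses (rho0 : 0 <= rho) (rho1 : rho < 1).
Hypothesis NE : forall x, N (E x) <= rho * N x.
Local Notation r := ((1 + rho) / 2).

Let rate_ge0 : 0 <= r.
Proof. move: rho0; lra. Qed.

Let rate_lt1 : r < 1.
Proof. move: rho1; lra. Qed.

(** The recursion preserves the bound [r] because [(rho + r^2) / 2 <= r]. *)
Lemma sqrt_iter_le n x : N (Z n x) <= r * N x.
Proof.
elim: n x => [|n IH] x /=.
  by rewrite /form_norm (hre0l hb) sqrtr0 mulr_ge0 ?sqrtr_ge0// rate_ge0.
rewrite (form_normZ hb)// ?invr_ge0//.
have := form_normD hb b0 (E x) (Z n (Z n x)).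
have := NE x; have := IH (Z n x); have : r * N (Z n x) <= r * (r * N x).
  by rewrite ler_wpM2l// rate_ge0.
have : (rho + r * r) * N x <= (2 * r) * N x.
  rewrite ler_wpM2r ?form_norm_ge0//.
  (* [2 r - rho - r^2] equals a quarter of this product. *)
  have : 0 <= (1 - rho) * (3 + rho) by rewrite mulr_ge0//; move: rho0 rho1; lra.
  lra.
lra.
Qed.

(** In the factored step each of the two iterates contributes a factor [r], and the half averages
    them. *)
Lemma sqrt_iter_step_le n x : N (Z n.+1 x - Z n x) <= r ^+ n * N x.
Proof.
elim: n x => [|n IH] x.
  rewrite expr0 mul1r subr0 /= addr0 (form_normZ hb) ?invr_ge0//.
  have : rho * N x <= 1 * N x by rewrite ler_wpM2r ?form_norm_ge0// ltW.
  have := NE x; have := form_norm_ge0 (b := b) x; lra.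
rewrite sqrt_iter_step (form_normZ hb) ?invr_ge0// exprS.
have := form_normD hb b0 (Z n.+1 (Z n.+1 x - Z n x)) (Z n (Z n.+1 x - Z n x)).
have := sqrt_iter_le n.+1 (Z n.+1 x - Z n x).
have := sqrt_iter_le n (Z n.+1 x - Z n x).
have : r * N (Z n.+1 x - Z n x) <= r * (r ^+ n * N x) by rewrite ler_wpM2l// rate_ge0.
set u := N (Z n.+1 x - Z n x); set v := N (_ + _).
move=> h1 h2 h3 h4; rewrite -mulrA; lra.
Qed.

Lemma sqrt_iter_dist_le k n x :
  N (Z (n + k)%N x - Z n x) <= r ^+ n * ((1 - r)^-1 * N x).
Proof.
have r1 : 0 < 1 - r by rewrite subr_gt0 rate_lt1.
(* The exact partial sum of the geometric series lets the induction on [k] close. *)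
suff : N (Z (n + k)%N x - Z n x) <= r ^+ n * (1 - r ^+ k) / (1 - r) * N x.
  move=> /le_trans; apply; rewrite -!mulrA ler_wpM2l ?exprn_ge0//.
  rewrite ler_piMl ?mulr_ge0 ?invr_ge0 ?form_norm_ge0// ?(ltW r1)//.
  by rewrite gerBl exprn_ge0.
elim: k => [|k IH].
  by rewrite addn0 subrr /form_norm (hre0l hb) sqrtr0 expr0 subrr mulr0 !mul0r.
rewrite addnS.
have -> : Z (n + k).+1 x - Z n x =
    (Z (n + k).+1 x - Z (n + k)%N x) + (Z (n + k)%N x - Z n x).
  by rewrite addrA subrK.
apply: le_trans (form_normD hb b0 _ _) _.
apply: le_trans (lerD (sqrt_iter_step_le _ _) IH) _.
rewrite le_eqVlt; apply/orP; left; apply/eqP.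
by rewrite exprD exprS; field; rewrite gt_eqF//; move: rho1; lra.
Qed.

Lemma sqrt_iter_cauchy x (e : R) : 0 < e -> exists M, forall m n,
  (M <= m)%N -> (M <= n)%N -> b (Z m x - Z n x) (Z m x - Z n x) < e.
Proof.
move=> e0.
have r1 : `|r| < 1 by rewrite ger0_norm.
pose C := (1 - r)^-1 * N x.
have : r ^+ n * C @[n --> \oo] --> 0 * C by apply: cvgMl; exact: cvg_expr.
rewrite mul0r => /cvgrPdist_lt.
move=> /(_ (Num.sqrt e / 2)); rewrite divr_gt0 ?sqrtr_gt0// => /(_ isT)[M _ hM].
exists M => m n Mm Mn.
(* Both iterates are compared with the [M]-th one, each within half of [sqrt e]. *)
have near p : (M <= p)%N -> N (Z p x - Z M x) < Num.sqrt e / 2.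
  move=> Mp; have := hM M (leqnn M); rewrite /= sub0r normrN.
  apply: le_lt_trans; apply: le_trans (ler_norm _).
  by rewrite -(subnKC Mp); exact: sqrt_iter_dist_le.
have -> : Z m x - Z n x = (Z m x - Z M x) + (-1 : R)%:C *: (Z n x - Z M x).
  by rewrite rmorphN1 scaleN1r opprB addrA subrK.
set u := Z m x - _; set v := Z n x - _.
have : N (u + (-1 : R)%:C *: v) < Num.sqrt e.
  apply: le_lt_trans (form_normD hb b0 _ _) _.
  have -> : N ((-1 : R)%:C *: v) = N v.
    by rewrite /form_norm (hreZl hb) (hreZr hb) !mulN1r opprK.
  by have := near _ Mm; have := near _ Mn; rewrite -/u -/v; lra.
rewrite -(form_norm_sqr b0) -ltr_sqr ?nnegrE ?form_norm_ge0 ?sqrtr_ge0//.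
by rewrite [X in _ < X]sqr_sqrtr ?(ltW e0).
Qed.

End sqrt_iteration.

(** * Operators representing forms *)

Lemma hermitian_reB {R : realType} {H : hilbertType R} (b g : H -> H -> R)
    (s t : R) : hermitian_re b -> hermitian_re g ->
  hermitian_re (fun x y => s * b x y - t * g x y).
Proof.
move=> hb hg; split=> *.
- by rewrite (hreC hb) (hreC hg).
- by rewrite (hreDl hb) (hreDl hg); ring.
- by rewrite (hreZl hb) (hreZl hg); ring.
- by rewrite (hre_adj hb) (hre_adj hg).
Qed.

Section form_operators.
Context {R : realType} {H : hilbertType R} {b : H -> H -> R} {A B : R}.
Hypotheses (hb : hermitian_re b) (A0 : 0 < A).
Hypotheses (Ab : forall x, A * rnorm x ^+ 2 <= b x x)
  (bB : forall x, b x x <= B * rnorm x ^+ 2).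
Let b0 := eqf_ge0 A0 Ab.

(** Riesz representation with respect to [b] gives [E]. Cauchy-Schwarz for [e] at [x] and [E x]
    yields [b (E x) (E x)^2 <= rho^2 * b x x * b (E x) (E x)], hence the norm bound. *)
Lemma form_operator (e : H -> H -> R) (rho : R) : hermitian_re e -> 0 <= rho ->
  (forall x, 0 <= e x x) -> (forall x, e x x <= rho * b x x) ->
  exists E : {linear H -> H}, (forall x y, b (E x) y = e x y) /\
    forall x, form_norm b (E x) <= rho * form_norm b x.
Proof.
move=> he rho0 e0 eb.
have /choice[E bE] x : exists z, forall y, b y z = e y x.
  apply: (eqf_Riesz hb A0 Ab bB (fun y => e y x) (rho * e x x)).
  - by move=> y z; rewrite (hreDl he).
  - by move=> t y; rewrite (hreZl he).
  - by rewrite mulr_ge0.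
  - move=> y; apply: le_trans (hre_CauchySchwarz he _ _ e0) _.
    by rewrite [leRHS]mulrAC ler_wpM2r.
have [F FE] : exists F : {linear H -> H}, forall x, F x = E x.
  apply: linear_exists => a x y; apply: (eqf_inj hb A0 Ab) => z.
  rewrite bE (hreDr hb) (hreDr he) bE; congr (_ + _).
  by rewrite (hreC he) (hre_adj he) (hreC hb) (hre_adj hb) (hreC hb) bE (hreC he).
have bF x y : b (F x) y = e x y by rewrite FE (hreC hb) bE (hreC he).
exists F; split=> // x.
have bFx : b (F x) (F x) <= rho ^+ 2 * b x x.
  have := hre_CauchySchwarz he x (F x) e0; rewrite -bF.
  have : e x x * e (F x) (F x) <= (rho * b x x) * (rho * b (F x) (F x)).
    by rewrite ler_pM.
  move=> /[swap]/le_trans/[apply].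
  have := b0 (F x); rewrite le_eqVlt => /predU1P[<- _|bF0].
    by rewrite mulr_ge0 ?sqr_ge0.
  rewrite [leRHS](_ : _ = (rho ^+ 2 * b x x) * b (F x) (F x)); last by ring.
  by rewrite expr2 ler_pM2r.
rewrite -ler_sqr ?nnegrE ?mulr_ge0 ?form_norm_ge0// exprMn.
by rewrite !(form_norm_sqr b0).
Qed.

(** If [G] represents [g] with respect to [b], then [E = 1 - G / C] has norm at most
    [1 - c / C < 1]. The iteration therefore converges to [1 - sqrt (G / C)], and
    [W = sqrt C * sqrt (G / C)] is the square root of [G]. *)
Lemma form_sqrt (g : H -> H -> R) (c C : R) : hermitian_re g -> 0 < c -> c <= C ->
  (forall x, c * b x x <= g x x) -> (forall x, g x x <= C * b x x) ->
  exists W : {linear H -> H}, (forall x y, b (W x) y = b x (W y)) /\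
    forall x, b (W x) (W x) = g x x.
Proof.
move=> hg c0 cC cg gC.
have C0 : 0 < C by apply: lt_le_trans cC.
pose e x y := 1 * b x y - C^-1 * g x y.
have he : hermitian_re e by exact: hermitian_reB.
have e0 x : 0 <= e x x by rewrite /e mul1r subr_ge0 ler_pdivrMl.
pose rho := 1 - c / C.
have rho0 : 0 <= rho by rewrite subr_ge0 ler_pdivrMr// mul1r.
have rho1 : rho < 1 by rewrite ltrBlDr ltrDl divr_gt0.
have eb x : e x x <= rho * b x x.
  rewrite /e /rho mulrBl lerB// mulrAC [leLHS]mulrC.
  by rewrite ler_wpM2l ?invr_ge0 ?(ltW C0).
have [E [bE NE]] := form_operator e rho he rho0 e0 eb.
have symE x y : b (E x) y = b x (E y) by rewrite bE (hreC hb x) bE (hreC he).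
have /choice[Z Zcvg] x := eqf_complete A0 Ab bB _
  (fun e => sqrt_iter_cauchy E hb b0 rho0 rho1 NE x e).
have cvgl x y : b (sqrt_iter E n x) y @[n --> \oo] --> b (Z x) y.
  by apply: (eqf_cvgl hb A0 Ab); exact: Zcvg.
have lim_inj (u : nat -> R) (l l' : R) :
    u n @[n --> \oo] --> l -> u n @[n --> \oo] --> l' -> l = l'.
  exact: norm_cvg_unique.
have [F FZ] : exists F : {linear H -> H}, forall x, F x = Z x.
  apply: linear_exists => a x y; apply: (eqf_inj hb A0 Ab) => z.
  rewrite (hreDr hb) !(hreC hb z) (hre_adj hb).
  apply: (lim_inj _ _ _ (cvgl _ _)).
  have -> : (fun n => b (sqrt_iter E n (a *: x + y)) z) =
      (fun n => b (sqrt_iter E n x) (a^* *: z) + b (sqrt_iter E n y) z).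
    by apply/funext => n; rewrite sqrt_iterP (hreDl hb) (hre_adj hb).
  by apply: cvgD; exact: cvgl.
have symF x y : b (F x) y = b x (F y).
  rewrite !FZ (hreC hb x).
  apply: (lim_inj _ _ _ (cvgl _ _)).
  under eq_fun do rewrite (sqrt_iter_sym E hb symE) (hreC hb x).
  exact: cvgl.
(* [Z = (E + Z ^ 2) / 2], tested against [x] *)
have FF x : b (F x) (F x) = 2 * b (F x) x - e x x.
  rewrite !FZ.
  apply: (lim_inj _ _ _ (eqf_cvg2 hb A0 Ab _ _ (Zcvg x))).
  have -> : (fun n => b (sqrt_iter E n x) (sqrt_iter E n x)) =
      (fun n => 2 * b (sqrt_iter E n.+1 x) x - e x x).
    apply/funext => n /=; rewrite (hreZl hb) (hreDl hb) bE.
    by rewrite (sqrt_iter_sym E hb symE) (hreC hb x); field.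
  apply: cvgB; last exact: cvg_cst.
  (* The recursion expresses the square of iterate [n] through iterate [n.+1]; the shift leaves the
     limit unchanged. *)
  by apply: cvgMr; have := cvgl x x; rewrite -(cvg_shiftS _).
pose s := (Num.sqrt C)%:C.
have [W WE] : exists W : {linear H -> H}, forall x, W x = s *: (x - F x).
  apply: linear_exists => a x y; rewrite linearP opprD addrACA -scalerBr.
  by rewrite scalerDr !scalerA [s * a]mulrC.
exists W; split=> x; first by move=> y; rewrite !WE (hreZl hb) (hreZr hb)
  (hreBl hb) (hreBr hb) symF.
rewrite WE (hreZl hb) (hreZr hb) mulrA -expr2 sqr_sqrtr ?(ltW C0)//.
(* By [FF] the terms in [F] collapse to [- e x x], and [C * (b x x - e x x) = g x x]. *)
rewrite (hreBl hb) !(hreBr hb) FF (hreC hb x) /e.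
by field; rewrite gt_eqF.
Qed.

Lemma form_isometries : 0 < B ->
  exists (X Y : {linear H -> H}) (a : R[i]),
    [/\ forall x, b (X x) (X x) = rnorm x ^+ 2,
        forall x, b (Y x) (Y x) = rnorm x ^+ 2 &
        forall x, x = a *: X x + a *: Y x].
Proof.
(* [2 * D] is the [c^2] of the construction; the factor 2 yields [b <= g]. The maximum secures
   [A <= D], since [A <= B] can fail when [H] is zero. *)
move=> B0; pose D := Num.max A B.
have AD : A <= D by rewrite le_max lexx.
have BD : B <= D by rewrite le_max lexx orbT.
have D0 : 0 < D by apply: lt_le_trans AD.
pose g x y := (2 * D) * rdot x y - 1 * b x y.
have [|||x|x|W [symW WW]] := form_sqrt g 1 (2 * D / A).
- exact: hermitian_reB hermitian_re_rdot hb.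
- by [].
- by rewrite ler_pdivlMr// mul1r; lra.
- rewrite /g rdotxx; have := bB x.
  have : B * rnorm x ^+ 2 <= D * rnorm x ^+ 2 by rewrite ler_wpM2r ?sqr_ge0.
  lra.
- rewrite /g rdotxx mul1r lerBlDr ler_wpDr// -!mulrA ler_pM2l// ler_pM2l//.
  by rewrite ler_pdivlMl.
pose i : R[i] := 'i.
(* [x -> i W x] is skew for the real form [b], so the cross terms in [b (X x) (X x)] and
   [b (Y x) (Y x)] vanish. *)
have biW x : b x (i *: W x) = 0.
  have : b x (i *: W x) = - b x (i *: W x).
    rewrite {1}(hreC hb) (hre_adj hb) symW linearZ /= conjCi scaleNr.
    exact: hreNr.
  lra.
have biWiW x : b (i *: W x) (i *: W x) = g x x.
  by rewrite (hre_adj hb) scalerA conjCi mulNr -expr2 sqrCi opprK scale1r WW.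
pose s := Num.sqrt (2 * D).
have s0 : 0 < s by rewrite sqrtr_gt0 mulr_gt0.
have s2 : s ^+ 2 = 2 * D by rewrite sqr_sqrtr// ltW// mulr_gt0.
have mk (j : R[i]) : exists X : {linear H -> H}, forall x,
    X x = (s^-1)%:C *: (x + j *: W x).
  apply: linear_exists => a x y; rewrite linearP !scalerDr !scalerA addrACA.
  by congr (_ *: _ + _ *: _ + _); ring.
have [[X XE] [Y YE]] := (mk i, mk (- i)).
have sb x : s^-1 * (s^-1 * (b x x + g x x)) = rnorm x ^+ 2.
  rewrite /g rdotxx mul1r addrC subrK mulrA -expr2 exprVn s2 mulKf//.
  by rewrite gt_eqF// mulr_gt0.
exists X, Y, (s / 2)%:C; split=> x.
- rewrite XE (hreZl hb) (hreZr hb) -sb (hreDl hb) !(hreDr hb).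
  by rewrite (hreC hb (i *: _) x) biW biWiW add0r addr0.
- rewrite YE scaleNr (hreZl hb) (hreZr hb) -sb (hreBl hb) !(hreBr hb).
  by rewrite (hreC hb (i *: _) x) biW biWiW sub0r subr0 opprK.
- rewrite XE YE -!scalerDr scaleNr addrACA subrr addr0 !scalerA -rmorphM.
  have -> : s / 2 * s^-1 = 2^-1 by field; rewrite gt_eqF.
  have half2 : 2^-1 + 2^-1 = 1 :> R by field.
  by rewrite scalerDr -scalerDl -rmorphD half2 rmorph1 scale1r.
Qed.

End form_operators.

Lemma rnorm0 {R : realType} {H : hilbertType R} : rnorm (0 : H) = 0.
Proof. by rewrite /rnorm normr0. Qed.

Lemma rnorm_gt0 {R : realType} {H : hilbertType R} (x : H) : x != 0 -> 0 < rnorm x.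
Proof. by rewrite -normr_gt0 rnormE ltcR. Qed.

(** Follows from positivity of the squared norms of [x + y] and [x - y]; it dominates the mixed
    integrands. *)
Lemma rdot_norm_le {R : realType} {H : hilbertType R} (x y : H) :
  `|rdot x y| <= rnorm x ^+ 2 + rnorm y ^+ 2.
Proof.
have hd := @hermitian_re_rdot R H.
have d0 (z : H) : 0 <= rdot z z by rewrite rdotxx sqr_ge0.
have := d0 (x + y); have := d0 (x - y); have := d0 x; have := d0 y.
rewrite (hreBl hd) !(hreBr hd) (hreDl hd) !(hreDr hd) (hreC hd y x) -!rdotxx.
by rewrite ler_norml => *; apply/andP; split; lra.
Qed.

(** * Strong measurability *)

Section strong_measurability.
Context {d : measure_display} {Omega : measurableType d} {R : realType}.
Context {Hs : Omega -> hilbertType R}.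
Implicit Types phi : forall w, Hs w.
Local Notation inj v := (@direct_sum_inj R Omega Hs _ v).

Lemma direct_sum_injP (w : Omega) (v : Hs w) : @direct_sum R Omega Hs (inj v).
Proof.
rewrite /direct_sum /= /sqnorm_sum.
have -> : \esum_(i in [set: Omega]) (rnorm (inj v i) ^+ 2)%:E =
    \esum_(i in [set w]) (rnorm (inj v i) ^+ 2)%:E :> \bar R.
  rewrite [RHS]esum_mkcond; apply: eq_esum => i _.
  case: ifPn => //; rewrite notin_setE => /= /eqP iw.
  by rewrite /direct_sum_inj dfwithout 1?eq_sym// rnorm0 expr0n.
by rewrite esum_set1 ?ltry// lee_fin sqr_ge0.
Qed.

(* Vectors in distinct summands are far apart, so that for any set [S] of
   indices the set of vectors with a nonzero component in [S] is open. *)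
Lemma strongly_measurable_sub phi (S : set Omega) : strongly_measurable phi ->
  (forall w, S w -> phi w <> 0) -> measurable S.
Proof.
move=> mphi Sphi.
pose U : set (forall w, Hs w) :=
  [set y | @direct_sum R Omega Hs y /\ exists2 i, S i & y i <> 0].
have -> : S = [set w | U (inj (phi w))].
  apply/seteqP; split=> w /= => [Sw|[_ [i Si]]].
    split; first exact: direct_sum_injP.
    by exists w => //; rewrite /direct_sum_inj dfwithin; exact: Sphi.
  have [->//|iw] := eqVneq w i.
  by rewrite /direct_sum_inj dfwithout.
apply: mphi; apply: sub_sigma_algebra; split=> [y []//|x [xD [i Si xi]]].
(* Any [y] with zero [i]-th component is at distance at least [rnorm (x i)] from [x]. *)
exists (rnorm (x i)); split; first by apply: rnorm_gt0; exact/eqP.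
move=> y yD; rewrite /sqnorm_sum => xy; split=> //; exists i => // yi0.
move: xy; apply/negP; rewrite -leNgt; apply: esum_ge.
exists [set i]; first by split => //; exact: finite_set1.
by rewrite fsbig_set1 yi0 sub0r /rnorm normrN.
Qed.

(** Every subset of the support of [phi] is measurable. Either the preimage of [Y] or that of its
    complement avoids the zeros of [g], hence lies in this support. *)
Lemma strongly_measurable_fun phi (g : Omega -> R) : strongly_measurable phi ->
  (forall w, phi w = 0 -> g w = 0) -> measurable_fun setT g.
Proof.
move=> mphi g0 _ Y mY; rewrite setTI.
have [Y0|Y0] := pselect (Y 0); last first.
  by apply: (strongly_measurable_sub _ _ mphi) => w /= + /g0 gw; rewrite gw.
rewrite -[X in measurable X]setCK; apply: measurableC.
by apply: (strongly_measurable_sub _ _ mphi) => w /= + /g0 gw; rewrite gw.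
Qed.

End strong_measurability.

(** * The form of a frame *)

Section frame_form.
Context {d : measure_display} {Omega : measurableType d} {R : realType}.
Context {mu : {measure set Omega -> \bar R}}.
Context {H : hilbertType R} {Hs : Omega -> hilbertType R}.
Context {L : forall w, 'B(H, Hs w)}.
Hypothesis mL : forall f : H, strongly_measurable (fun w => L w f).
Hypothesis finL : forall f : H, (sqnorm_integral mu (fun w => L w f) < +oo)%E.

Definition frame_form (f g : H) : R :=
  Rintegral mu setT (fun w => rdot (L w f) (L w g)).

Lemma sqr_integrable (f : H) :
  mu.-integrable setT (fun w => (rnorm (L w f) ^+ 2)%:E).
Proof.
apply/integrableP; split.
  apply/measurable_EFinP; apply: (strongly_measurable_fun _ _ (mL f)) => w ->.
  by rewrite rnorm0 expr0n.
apply: le_lt_trans (finL f); rewrite le_eqVlt; apply/orP; left; apply/eqP.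
by apply: eq_integral => w _; rewrite gee0_abs// lee_fin sqr_ge0.
Qed.

(** The pairing vanishes wherever [L w f] does, hence is measurable; the two squared norms dominate
    it. *)
Lemma rdot_integrable (f g : H) :
  mu.-integrable setT (EFin \o (fun w => rdot (L w f) (L w g))).
Proof.
apply: (le_integrable measurableT _ _
  (integrableD measurableT (sqr_integrable f) (sqr_integrable g))).
  apply/measurable_EFinP; apply: (strongly_measurable_fun _ _ (mL f)) => w ->.
  by rewrite (hre0l hermitian_re_rdot).
move=> w _ /=; rewrite lee_fin; apply: le_trans (ler_norm _).
exact: rdot_norm_le.
Qed.

Lemma hermitian_re_frame_form : hermitian_re frame_form.
Proof.
split=> [f g|f g h|t f g|a f g]; rewrite /frame_form.
- by apply: eq_Rintegral => w _; rewrite rdotC.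
- rewrite -RintegralD//; try exact: rdot_integrable.
  by apply: eq_Rintegral => w _; rewrite linearD rdotDl.
- rewrite -RintegralZl//; last exact: rdot_integrable.
  by apply: eq_Rintegral => w _; rewrite linearZ rdotZl.
- by apply: eq_Rintegral => w _; rewrite !linearZ rdot_adj.
Qed.

(** The extended integral is finite, so reading it as a real loses nothing. This turns the frame
    inequalities into bounds on [frame_form]. *)
Lemma sqnorm_integralE (f : H) :
  sqnorm_integral mu (fun w => L w f) = (frame_form f f)%:E.
Proof.
rewrite /frame_form /Rintegral fineK; last first.
  by apply: integrable_fin_num => //; exact: rdot_integrable.
by apply: eq_integral => w _; rewrite rdotxx.
Qed.

End frame_form.

(** * Parseval frames by composition *)

Lemma bounded_operator_comp {R : realType} {H K : hilbertType R} (T : 'B(H, K))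
    (X : {linear H -> H}) (M : R) : (forall x, rnorm (X x) <= M * rnorm x) ->
  exists S : 'B(H, K), forall x, S x = T (X x).
Proof.
move=> XM; have [M' TM'] := bop_bounded T.
suff bTX : exists N : R, forall x, rnorm ((T \o X) x) <= N * rnorm x.
  by exists (@BoundedOperator R H K ((T : {linear H -> K}) \o X) bTX).
(* [M'] may be negative when [H] is zero; the maximum keeps multiplication by it monotone. *)
exists (Num.max 0 M' * M) => x /=; apply: le_trans (TM' _) _.
rewrite -mulrA; apply: (@le_trans _ _ (Num.max 0 M' * rnorm (X x))).
  by rewrite ler_wpM2r ?rnorm_ge0// le_max lexx orbT.
by rewrite ler_wpM2l// le_max lexx.
Qed.

Theorem theorem3p9 (R : realType) (d : measure_display) (Omega : measurableType d)
    (mu : {measure set Omega -> \bar R})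
    (H : hilbertType R) (Hs : Omega -> hilbertType R)
    (sepH : separable H) (sepHs : forall w : Omega, separable (Hs w))
    (Theta : forall w : Omega, 'B(H, Hs w))
    (onbTheta : cg_orthonormal_basis mu Theta)
    (Lambda : forall w : Omega, 'B(H, Hs w))
    (frameLambda : cg_frame mu Lambda) :
  exists (Gamma Psi : forall w : Omega, 'B(H, Hs w)) (a b : R[i]),
    [/\ parseval_cg_frame mu Gamma,
        parseval_cg_frame mu Psi &
        {ae mu, forall w : Omega, forall f : H,
           Lambda w f = a *: Gamma w f + b *: Psi w f}].
Proof.
have [A [B [A0 B0 [mL ABL]]]] := frameLambda.
have finL f : (sqnorm_integral mu (fun w => Lambda w f) < +oo)%E.
  by apply: le_lt_trans (ABL f).2 (ltry _).
pose b := @frame_form _ _ _ mu _ _ Lambda.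
have hb : hermitian_re b by exact: hermitian_re_frame_form.
have Lb f : sqnorm_integral mu (fun w => Lambda w f) = (b f f)%:E.
  exact: sqnorm_integralE.
have Ab f : A * rnorm f ^+ 2 <= b f f by rewrite -lee_fin -Lb; case: (ABL f).
have bB f : b f f <= B * rnorm f ^+ 2 by rewrite -lee_fin -Lb; case: (ABL f).
have [X [Y [a [bX bY aXY]]]] := form_isometries hb A0 Ab bB B0.
(* Composing with an isometry from the norm of [H] to [b] makes [Lambda] Parseval. *)
have parseval (Z : {linear H -> H}) : (forall f, b (Z f) (Z f) = rnorm f ^+ 2) ->
    exists G : forall w, 'B(H, Hs w), (forall w f, G w f = Lambda w (Z f)) /\
      parseval_cg_frame mu G.
  move=> bZ.
  (* The lower frame bound gives [A |Z f|^2 <= b (Z f) (Z f) = |f|^2]. *)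
  have ZM f : rnorm (Z f) <= (Num.sqrt A)^-1 * rnorm f.
    rewrite ler_pdivlMl ?sqrtr_gt0//.
    rewrite -ler_sqr ?nnegrE ?mulr_ge0 ?sqrtr_ge0 ?rnorm_ge0//.
    by rewrite exprMn sqr_sqrtr ?(ltW A0)// -(bZ f) Ab.
  pose G w := sval (cid (bounded_operator_comp (Lambda w) Z _ ZM)).
  have GE w f : G w f = Lambda w (Z f).
    exact: (svalP (cid (bounded_operator_comp (Lambda w) Z _ ZM))).
  have GLE f : (fun w => G w f) = (fun w => Lambda w (Z f)).
    by apply: functional_extensionality_dep => w; exact: GE.
  exists G; split=> //; split=> f; rewrite GLE; first exact: mL.
  by rewrite Lb bZ mul1r lexx.
have [Gamma [GE pG]] := parseval X bX.
have [Psi [PE pP]] := parseval Y bY.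
exists Gamma, Psi, a, a; split=> //.
apply: aeW => w f.
by rewrite GE PE [in LHS](aXY f) linearD !linearZ.
Qed.
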